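(* Let $\mathcal{K}_0\subseteq\mathbb{R}^{n_1}$ and $\mathcal{K}_i\subseteq\mathbb{R}^{n_2}$, $i\in[1:S]$, be closed convex cones, let $A\in\mathcal{S}^{n_1}$, $a\in\mathbb{R}^{n_1}$, $B_i\in\mathbb{R}^{n_1\times n_2}$, $C_i\in\mathcal{S}^{n_2}$, $c_i\in\mathbb{R}^{n_2}$, $F_i\in\mathbb{R}^{m_i\times n_1}$, $G_i\in\mathbb{R}^{m_i\times n_2}$, $r_i\in\mathbb{R}^{m_i}$, $i\in[1:S]$, and let $Q_j\colon\mathbb{R}^{n_1+Sn_2}\to\mathbb{R}$, $j\in[1:K]$, be (not necessarily homogeneous) quadratic functions of $(x,y_1,\dots,y_S)$ that involve no bilinear terms between $y_i$ and $y_l$ for $i\neq l$. Consider the problem $$\text{(P)}\quad \min_{x,y_1,\dots,y_S}\ x^{\mathsf T}Ax+a^{\mathsf T}x+\sum_{i=1}^S\left[x^{\mathsf T}B_iy_i+y_i^{\mathsf T}C_iy_i+c_i^{\mathsf T}y_i\right]$$ subject to $F_ix+G_iy_i=r_i$ $(i\in[1:S])$, $Q_j(x,y_1,\dots,y_S)=0$ $(j\in[1:K])$, $x\in\mathcal{K}_0$, $y_i\in\mathcal{K}_i$ $(i\in[1:S])$. Assume that for every $i\in[1:S]$ the set $\mathcal{F}_i:=\{(x,y_i)\in\mathcal{K}_0\times\mathcal{K}_i : F_ix+G_iy_i=r_i\}$ is nonempty and bounded, and that $$(x,y_i)\in\mathcal{F}_i \text{ for all } i\in[1:S]\ \Longrightarrow\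 Q_j(x,y_1,\dots,y_S)\ge 0 \text{ for all } j\in[1:K].$$ Then (P) is equivalent to (i.e. has the same optimal value as) the conic problem $$\text{(C)}\quad \min_{[X]\in\mathcal{S}^{S,n_1+1}_{n_1+n_2+1}}\ [C]\odot[X]$$ subject to $[H_0]\odot[X]=1$, $[F_i]\odot[X]=0$ $(i\in[1:S])$, $\hat Q_j([X])=0$ $(j\in[1:K])$, and $[X]\in\mathcal{CMP}\left((\mathbb{R}_+\times\mathcal{K}_0),\mathcal{K}_1,\dots,\mathcal{K}_S\right)$, where $$[C]:=\Gamma^{-1}\begin{pmatrix}0&\tfrac12a^{\mathsf T}&\tfrac12c_1^{\mathsf T}&\cdots&\tfrac12c_S^{\mathsf T}\\ \tfrac12a&A&\tfrac12B_1&\cdots&\tfrac12B_S\\ \tfrac12c_1&\tfrac12B_1^{\mathsf T}&C_1&\cdots&O\\ \vdots&\vdots&\vdots&\ddots&\vdots\\ \tfrac12c_S&\tfrac12B_S^{\mathsf T}&O&\cdots&C_S\end{pmatrix},\qquad [H_0]:=\Gamma^{-1}(e_1e_1^{\mathsf T}),$$ $$[F_i]:=\Gamma^{-1}\left((-r_i,F_i,O,\dots,G_i,\dots,O)^{\mathsf T}(-r_i,F_i,O,\dots,G_i,\dots,O)\right),$$ with $G_i$ placed in the block of columns corresponding to $y_i$, and $\hat Q_j\colon\mathcal{S}^{S,n_1+1}_{n_1+n_2+1}\to\mathbb{R}$ are the linear functions such that, for $z=(1,x^{\mathsf T},y_1^{\mathsf T},\dots,y_S^{\mathsf T})^{\mathsf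 T}$ and all $x\in\mathbb{R}^{n_1}$, $y_i\in\mathbb{R}^{n_2}$, one has $\hat Q_j(\Gamma^{-1}(zz^{\mathsf T}))=Q_j(x,y_1,\dots,y_S)$.
   Context: Notation: $[l:k]=\{l,l+1,\dots,k\}$; $\mathcal{S}^m$ is the space of real symmetric $m\times m$ matrices; $M\bullet N=\operatorname{trace}(M^{\mathsf T}N)$; $O$ is a zero matrix; $e_1$ is the first unit vector. The optimal value of an infeasible minimization problem is $+\infty$. Space of connected components: for $k\le n$, $\mathcal{S}_n^{S,k}$ is the set of $S$-tuples of symmetric $n\times n$ matrices sharing the same upper-left $k\times k$ block, $$\mathcal{S}_n^{S,k}=\left\{\left[\begin{pmatrix}X&Z_i^{\mathsf T}\\ Z_i&Y_i\end{pmatrix}\right]_{i\in[1:S]} : \begin{pmatrix}X&Z_i^{\mathsf T}\\ Z_i&Y_i\end{pmatrix}\in\mathcal{S}^n,\ i\in[1:S],\ X\in\mathcal{S}^k\right\}.$$ Elements are written $[A]$. The linear map $\Gamma$ sends such an element to the arrowhead matrix $$\Gamma=\begin{pmatrix}X&Z_1^{\mathsf T}&\cdots&Z_S^{\mathsf T}\\ Z_1&Y_1&\cdots&O\\ \vdots&\vdots&\ddots&\vdots\\ Z_S&O&\cdots&Y_S\end{pmatrix}\in\mathcal{S}^{k+S(n-k)},$$ an isomorphism onto the space of arrowhead matrices. $\Gamma^{-1}$ is extended to all matrices in $\mathcal{S}^{k+S(n-k)}$ by ignoring (treating as zero) the blocks in positions $(Y_i,Y_l)$ with $i\ne l$. The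 inner product is $[A]\odot[B]:=\Gamma([A])\bullet\Gamma([B])$; addition and scalar multiplication are transported via $\Gamma$. For convex cones $\mathcal{K}_0\subseteq\mathbb{R}^k$, $\mathcal{K}_i\subseteq\mathbb{R}^{n-k}$, $i\in[1:S]$, $$\mathcal{CMP}(\mathcal{K}_0,\dots,\mathcal{K}_S):=\operatorname{conv}\left\{\left[\begin{pmatrix}x\\ y_i\end{pmatrix}\begin{pmatrix}x\\ y_i\end{pmatrix}^{\mathsf T}\right]_{i\in[1:S]} : \begin{pmatrix}x\\ y_i\end{pmatrix}\in\mathcal{K}_0\times\mathcal{K}_i,\ i\in[1:S]\right\}\subseteq\mathcal{S}_n^{S,k}.$$ In problem (C), $k=n_1+1$, $n=n_1+n_2+1$, and the first cone is $\mathbb{R}_+\times\mathcal{K}_0\subseteq\mathbb{R}^{n_1+1}$. *)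

(* Defs.v *)
From HB Require Import structures.
From mathcomp Require Import all_boot all_order all_algebra.
From mathcomp Require Import all_classical all_reals all_analysis.

Set Implicit Arguments.
Unset Strict Implicit.
Unset Printing Implicit Defensive.

Import Order.TTheory GRing.Theory Num.Theory.
Import numFieldNormedType.Exports.

Local Open Scope classical_set_scope.
Local Open Scope ring_scope.

Section SymmetricMatrices.
Variables (R : realType) (n : nat).

Definition symmx_pred : {pred 'M[R]_n} := [pred A | A^T == A].

Record symmx := SymMx { symmx_val :> 'M[R]_n; _ : symmx_val \in symmx_pred }.

HB.instance Definition _ := [isSub for symmx_val].
HB.instance Definition _ := [Choice of symmx by <:].

Lemma symmx_pred_closed : subsemimod_closed symmx_pred.
Proof.
split; first split.
- by rewrite inE trmx0.
- by move=> A B /eqP sA /eqP sB; rewrite inE linearD /= sA sB.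
- by move=> a A /eqP sA; rewrite inE linearZ /= sA.
Qed.

HB.instance Definition _ :=
  GRing.SubChoice_isSubLmodule.Build R 'M[R]_n symmx_pred symmx
    symmx_pred_closed.

Lemma symmxE (A : symmx) : (A : 'M[R]_n)^T = A.
Proof. by case: A => A /= /eqP. Qed.

Lemma symmxD (A B : symmx) : (A + B : symmx) = (A : 'M[R]_n) + B :> 'M[R]_n.
Proof. by []. Qed.

Lemma symmxZ (a : R) (A : symmx) : (a *: A : symmx) = a *: (A : 'M[R]_n) :> 'M[R]_n.
Proof. by []. Qed.

Lemma mul_trmx_sym (m : nat) (V : 'M[R]_(m, n)) : V^T *m V \in symmx_pred.
Proof. by rewrite inE trmx_mul trmxK. Qed.

Lemma outer_sym (z : 'cV[R]_n) : z *m z^T \in symmx_pred.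
Proof. by rewrite inE trmx_mul trmxK. Qed.

Definition gram (m : nat) (V : 'M[R]_(m, n)) : symmx := SymMx (mul_trmx_sym V).

Definition outer (z : 'cV[R]_n) : symmx := SymMx (outer_sym z).

End SymmetricMatrices.

Arguments symmx R n : clear implicits.
Arguments symmx_pred {R n}.

(* [ccomp R S k p] is the space of connected components with [S.+1] components
   (so that at least one exists), common upper-left block of size [k] and
   matrices of size [k + p].  Being a linear subspace of the tuples of symmetric
   matrices, it carries the componentwise operations; they agree with those
   transported along the linear isomorphism [Gamma] (see [Gamma_is_linear]). *)
Section ConnectedComponents.
Variables (R : realType) (S k p : nat).

Definition ccomp_pred : {pred {ffun 'I_S.+1 -> symmx R (k + p)}} :=
  [pred A : {ffun 'I_S.+1 -> symmx R (k + p)} | [forall i, forall j,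
     ulsubmx (A i : 'M[R]_(k + p)) == ulsubmx (A j : 'M[R]_(k + p))]].

Record ccomp := CComp {
  ccomp_val :> {ffun 'I_S.+1 -> symmx R (k + p)};
  _ : ccomp_val \in ccomp_pred }.

HB.instance Definition _ := [isSub for ccomp_val].
HB.instance Definition _ := [Choice of ccomp by <:].

Lemma ccomp_predP (A : {ffun 'I_S.+1 -> symmx R (k + p)}) :
  reflect (forall i j,
      ulsubmx (A i : 'M[R]_(k + p)) = ulsubmx (A j : 'M[R]_(k + p)))
    (A \in ccomp_pred).
Proof.
apply: (iffP forallP) => [h i j|h i]; first by have /forallP/(_ j)/eqP := h i.
by apply/forallP => j; apply/eqP.
Qed.

Lemma ccomp_pred_closed : subsemimod_closed ccomp_pred.
Proof.
split; first split.
- by apply/ccomp_predP => i j; rewrite !ffunE.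
- move=> A B /ccomp_predP sA /ccomp_predP sB; apply/ccomp_predP => i j.
  by rewrite !ffunE !symmxD /ulsubmx !linearD /= -!/(ulsubmx _) (sA i j) (sB i j).
- move=> a A /ccomp_predP sA; apply/ccomp_predP => i j.
  by rewrite !ffunE !symmxZ /ulsubmx !linearZ /= -!/(ulsubmx _) (sA i j).
Qed.

HB.instance Definition _ :=
  GRing.SubChoice_isSubLmodule.Build R {ffun 'I_S.+1 -> symmx R (k + p)}
    ccomp_pred ccomp ccomp_pred_closed.

Definition ccX (A : ccomp) : 'M[R]_k := ulsubmx (A ord0 : 'M[R]_(k + p)).
Definition ccZ (A : ccomp) (i : 'I_S.+1) : 'M[R]_(p, k) :=
  dlsubmx (A i : 'M[R]_(k + p)).
Definition ccY (A : ccomp) (i : 'I_S.+1) : 'M[R]_p :=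
  drsubmx (A i : 'M[R]_(k + p)).

(* The size [k + \sum_(i < S.+1) p] is [k + S.+1 * p], in the form required by
   the block-matrix operations. *)
Definition Gamma_mx (A : ccomp) : 'M[R]_(k + \sum_(i < S.+1) p) :=
  block_mx (ccX A)             (\mxrow_i (ccZ A i)^T)
           (\mxcol_i ccZ A i)  (\mxdiag_i ccY A i).

Lemma Gamma_sym (A : ccomp) : Gamma_mx A \in symmx_pred.
Proof.
rewrite inE /Gamma_mx tr_block_mx tr_mxcol tr_mxrow tr_mxdiag /ccX /ccY.
rewrite trmx_ulsub symmxE; apply/eqP; congr block_mx.
- by apply: eq_mxcol => i; rewrite trmxK.
- by apply: eq_mxdiag => i; rewrite trmx_drsub symmxE.
Qed.

Definition Gamma (A : ccomp) : symmx R (k + \sum_(i < S.+1) p) :=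
  SymMx (Gamma_sym A).

(* Defined on all symmetric M: the blocks of M in positions (Y_i, Y_l), i != l,
   are ignored. *)
Definition Gammainv_mx (M : symmx R (k + \sum_(i < S.+1) p)) (i : 'I_S.+1) :
    'M[R]_(k + p) :=
  block_mx (ulsubmx M)               (submxrow (ursubmx M) i)
           (submxcol (dlsubmx M) i)  (submxblock (drsubmx M) i i).

Lemma Gammainv_sym M i : Gammainv_mx M i \in symmx_pred.
Proof.
rewrite inE /Gammainv_mx tr_block_mx trmx_ulsub tr_submxcol tr_submxrow.
by rewrite tr_submxblock trmx_drsub trmx_ursub trmx_dlsub symmxE.
Qed.

Lemma Gammainv_shared M : [ffun i => SymMx (Gammainv_sym M i)] \in ccomp_pred.
Proof. by apply/ccomp_predP => i j; rewrite !ffunE /= !block_mxKul. Qed.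

Definition Gammainv (M : symmx R (k + \sum_(i < S.+1) p)) : ccomp :=
  CComp (Gammainv_shared M).

Lemma GammaK : cancel Gamma Gammainv.
Proof.
move=> A; apply: val_inj; apply/ffunP => i; apply: val_inj; rewrite /= ffunE /=.
rewrite /Gammainv_mx /= /Gamma_mx block_mxKul block_mxKur block_mxKdl block_mxKdr.
rewrite mxrowK mxcolK submxblock_diag -[RHS]submxK /ccX /ccZ /ccY; congr block_mx.
  by case: A => A /= /ccomp_predP.
by rewrite trmx_dlsub symmxE.
Qed.

Lemma Gamma_is_linear : linear Gamma.
Proof.
move=> a A B; apply: val_inj; rewrite /= /Gamma_mx.
have E i : ((a *: A + B) i : 'M[R]_(k + p)) = a *: (A i : 'M[R]_(k + p)) + B i.
  by rewrite !ffunE.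
rewrite scale_block_mx add_block_mx /ccX /ccY /ccZ; congr block_mx.
- by rewrite E /ulsubmx !linearP.
- by apply/matrixP => u v; rewrite !mxE E !mxE.
- by apply/matrixP => u v; rewrite !mxE E !mxE.
- apply/matrixP => u v; rewrite !mxE; case: eqP => [e|_]; last first.
    by rewrite !mxE mulr0 addr0.
  by rewrite E; case: _ / e; rewrite !conform_mx_id !mxE.
Qed.

Definition ccdot (A B : ccomp) : R := \tr ((Gamma A)^T *m Gamma B).

Lemma outer_tuple_shared (x : 'cV[R]_k) (y : 'I_S.+1 -> 'cV[R]_p) :
  [ffun i => outer (col_mx x (y i))] \in ccomp_pred.
Proof.
apply/ccomp_predP => i j.
by rewrite !ffunE /= !tr_col_mx !mul_col_row !block_mxKul.
Qed.

Definition outer_tuple (x : 'cV[R]_k) (y : 'I_S.+1 -> 'cV[R]_p) : ccomp :=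
  CComp (outer_tuple_shared x y).

Definition CMP (K0 : set 'cV[R]_k) (K : 'I_S.+1 -> set 'cV[R]_p) : set ccomp :=
  smallest (@convex_set R ccomp)
    [set A | exists x y, [/\ K0 x, forall i, K i (y i) & A = outer_tuple x y]].

End ConnectedComponents.

Arguments ccomp R S k p : clear implicits.
Arguments ccomp_pred {R S k p}.

Section Cones.
Variable R : realType.

Definition convex_cone (n : nat) (K : set 'cV[R]_n) :=
  convex_set (K : set (convex_lmodType 'cV[R]_n)) /\
  forall t x, 0 <= t -> K x -> K (t *: x).

Definition nonneg_prod (n : nat) (K : set 'cV[R]_n) : set 'cV[R]_(1 + n) :=
  [set z | exists t x, [/\ 0 <= t, K x & z = col_mx t%:M x]].

End Cones.

Section Problem.
Variables (R : realType) (S n1 n2 : nat).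

Definition stack (x : 'cV[R]_n1) (y : 'I_S.+1 -> 'cV[R]_n2) :
    'cV[R]_(n1 + \sum_(i < S.+1) n2) :=
  col_mx x (\mxcol_i y i).

Definition hom_stack (x : 'cV[R]_n1) (y : 'I_S.+1 -> 'cV[R]_n2) :
    'cV[R]_((1 + n1) + \sum_(i < S.+1) n2) :=
  col_mx (col_mx 1%:M x) (\mxcol_i y i).

(* As [M] is symmetric, the bilinear term between y_i and y_l is
   absent if and only if the block (i, l) of [M] vanishes. *)
Definition separable_quadratic
    (Q : 'cV[R]_(n1 + \sum_(i < S.+1) n2) -> R) : Prop :=
  exists (M : symmx R (n1 + \sum_(i < S.+1) n2))
         (b : 'cV[R]_(n1 + \sum_(i < S.+1) n2)) (d : R),
    (forall i l, i != l -> submxblock (drsubmx M) i l = 0) /\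
    (forall v, Q v = (v^T *m M *m v + b^T *m v) 0 0 + d).

Definition objective (A : symmx R n1) (a : 'cV[R]_n1)
    (B : 'I_S.+1 -> 'M[R]_(n1, n2)) (C : 'I_S.+1 -> symmx R n2)
    (c : 'I_S.+1 -> 'cV[R]_n2) (x : 'cV[R]_n1) (y : 'I_S.+1 -> 'cV[R]_n2) : R :=
  (x^T *m A *m x + a^T *m x +
   \sum_i (x^T *m B i *m y i + (y i)^T *m C i *m y i + (c i)^T *m y i)) 0 0.

Definition feas (m : nat) (K0 : set 'cV[R]_n1) (K : set 'cV[R]_n2)
    (F : 'M[R]_(m, n1)) (G : 'M[R]_(m, n2)) (r : 'cV[R]_m) :
    set ('cV[R]_n1 * 'cV[R]_n2) :=
  [set u | [/\ K0 u.1, K u.2 & F *m u.1 + G *m u.2 = r]].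

Definition ccC_mx (A : symmx R n1) (a : 'cV[R]_n1)
    (B : 'I_S.+1 -> 'M[R]_(n1, n2)) (C : 'I_S.+1 -> symmx R n2)
    (c : 'I_S.+1 -> 'cV[R]_n2) : 'M[R]_((1 + n1) + \sum_(i < S.+1) n2) :=
  block_mx
    (block_mx 0            (2^-1 *: a^T)
              (2^-1 *: a)  A)
    (\mxrow_i col_mx (2^-1 *: (c i)^T) (2^-1 *: B i))
    (\mxcol_i row_mx (2^-1 *: c i) (2^-1 *: (B i)^T))
    (\mxdiag_i C i).

Lemma ccC_sym A a B C c : ccC_mx A a B C c \in symmx_pred.
Proof.
rewrite inE /ccC_mx !tr_block_mx tr_mxcol tr_mxrow tr_mxdiag symmxE trmx0.
rewrite !linearZ /= trmxK; apply/eqP; congr block_mx.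
- by apply: eq_mxrow => i; rewrite tr_row_mx !linearZ /= trmxK.
- by apply: eq_mxcol => i; rewrite tr_col_mx !linearZ /= trmxK.
- by apply: eq_mxdiag => i; rewrite symmxE.
Qed.

Definition ccC A a B C c : ccomp R S (1 + n1) n2 :=
  Gammainv (SymMx (ccC_sym A a B C c)).

Definition ccH0 : ccomp R S (1 + n1) n2 :=
  Gammainv (outer (delta_mx (lshift _ (lshift _ 0)) 0)).

Definition ccF_mx (m : nat) (F : 'M[R]_(m, n1)) (G : 'M[R]_(m, n2))
    (r : 'cV[R]_m) (i : 'I_S.+1) : 'M[R]_(m, (1 + n1) + \sum_(l < S.+1) n2) :=
  row_mx (row_mx (- r) F) (\mxrow_l (if l == i then G else 0)).

Definition ccF (m : nat) (F : 'M[R]_(m, n1)) (G : 'M[R]_(m, n2))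
    (r : 'cV[R]_m) (i : 'I_S.+1) : ccomp R S (1 + n1) n2 :=
  Gammainv (gram (ccF_mx F G r i)).

End Problem.

Arguments ccH0 R S n1 n2 : clear implicits.

(* Main.v *)
(** Every feasible point z = (1, x, y) of (P) yields the feasible point
    Gammainv (z z^T) of (C) with the same value, so only (P) <= (C) is at stake.
    For a real lower bound v of (P), consider the X such that
    [F_i] . X >= 0 for all i and, if these all vanish, Qhat_j X >= 0 for all j
    and, if these vanish as well, v ([H_0] . X) <= [C] . X.  These X form a
    convex cone, because a sum of nonnegative numbers vanishes only if every
    summand does.  The cone contains the generators of CMP: a generator (t, x, y)
    with [F_i] . X = |F_i x + G_i y_i - t r_i|^2 = 0 for all i is, when t > 0, a
    multiple of the lift of a point satisfying the linear and conic constraints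
    (where Q_j >= 0), and, when t = 0, zero, because (x, y_i) is then a recession
    direction of the bounded nonempty set of points feasible for block i.  Hence
    it contains CMP, and in particular the feasible set of (C).  Infeasibility of
    (P) is covered, since every v is then a lower bound. *)

From HB Require Import structures.
Require Import Defs.
From mathcomp Require Import all_boot all_order all_algebra.
From mathcomp Require Import all_classical all_reals all_analysis.
From mathcomp Require Import lra ssrAC.

Set Implicit Arguments.
Unset Strict Implicit.
Unset Printing Implicit Defensive.

Import Order.TTheory GRing.Theory Num.Theory.
Import numFieldNormedType.Exports.

Local Open Scope classical_set_scope.
Local Open Scope ring_scope.

(** * Recession directions and sums in convex cones *)

Lemma bounded_ray (R : realType) (V : normedModType R) (A : set V) (u d : V) :
  bounded_set A -> (forall t : R, 0 <= t -> A (u + t *: d)) -> d = 0.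
Proof.
move=> /pinfty_ex_gt0[M M0 AM] Aray; apply/eqP/negPn/negP => d0.
have nd : 0 < `|d| by rewrite normr_gt0.
(* This choice gives [t *: d] norm M + |u| + 1, hence [u + t *: d] norm at least M + 1, beyond the
   bound M. *)
pose t := (M + `|u| + 1) / `|d|.
have t0 : 0 <= t by rewrite divr_ge0 ?addr_ge0 ?normr_ge0 ?(ltW M0).
have := AM _ (Aray _ t0); rewrite /= leNgt => /negP; apply.
apply: (@lt_le_trans _ _ (`|t *: d| - `|u|)).
  by rewrite normrZ ger0_norm // divfK ?gt_eqF // addrAC addrK ltrDl.
by rewrite lerBlDr addrC -[X in `|X| <= _](addKr u) -(normrN u) ler_normD.
Qed.

(** The sum is twice the midpoint, and the midpoint lies in [K] by convexity. *)
Lemma convex_coneD (R : realType) n (K : set 'cV[R]_n) x y :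
  convex_cone K -> K x -> K y -> K (x + y).
Proof.
move=> [Kc KZ] Kx Ky.
have /(KZ 2) : K (2^-1 *: (x + y)).
  have h0 : 0 <= 2^-1 :> R by rewrite invr_ge0.
  have h1 : 2^-1 <= 1 :> R by lra.
  have /set_mem := Kc x y (Itv01 h0 h1) (mem_set Kx) (mem_set Ky).
  congr K; rewrite [RHS]scalerDr; congr (_ + _); congr (_ *: _).
  by rewrite /= /unstable.onem; lra.
by rewrite scalerA divff // scale1r; apply.
Qed.

(** * The inner product with a generator as a quadratic form *)

Section Quadratic.
Variables (R : realType) (S k p : nat).
Implicit Types (x : 'cV[R]_k) (y : 'I_S.+1 -> 'cV[R]_p).

Lemma outer_tupleZ (t : R) x y :
  outer_tuple (t *: x) (fun i => t *: y i) = t ^+ 2 *: outer_tuple x y.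
Proof.
apply: val_inj; apply/ffunP => i; apply: val_inj.
rewrite /= !ffunE /= -scale_col_mx linearZ /= -scalemxAl -scalemxAr scalerA.
by rewrite -expr2.
Qed.

Lemma Gammainv_outer x y :
  Gammainv (outer (col_mx x (\mxcol_i y i))) = outer_tuple x y.
Proof.
apply: val_inj; apply/ffunP => i; apply: val_inj; rewrite /= !ffunE /=.
rewrite /Gammainv_mx /= !tr_col_mx !mul_col_row.
rewrite block_mxKul block_mxKur block_mxKdl block_mxKdr.
rewrite tr_mxcol mul_mxrow mxcol_mul mul_mxcol_mxrow.
by rewrite mxrowK mxcolK mxblockK.
Qed.

(** The blocks (i, l), i != l, of [Gamma A] are zero, so the trace does not see the products y_i
    y_l^T by which z z^T differs from the arrowhead form of the tuple. *)
Lemma ccdot_outer (A : ccomp R S k p) x y (z := col_mx x (\mxcol_i y i)) :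
  ccdot A (outer_tuple x y) = (z^T *m Gamma A *m z) 0 0.
Proof.
rewrite -trace_mx11 mxtrace_mulC mulmxA [RHS]mxtrace_mulC /ccdot symmxE.
rewrite /z tr_col_mx mul_col_row /= /Gamma_mx.
rewrite tr_mxcol mul_mxrow mxcol_mul mul_mxcol_mxrow.
have EX : ccX (outer_tuple x y) = x *m x^T.
  by rewrite /ccX /= ffunE /= tr_col_mx mul_col_row block_mxKul.
have EZ i : ccZ (outer_tuple x y) i = y i *m x^T.
  by rewrite /ccZ /= ffunE /= tr_col_mx mul_col_row block_mxKdl.
have EY i : ccY (outer_tuple x y) i = y i *m (y i)^T.
  by rewrite /ccY /= ffunE /= tr_col_mx mul_col_row block_mxKdr.
rewrite EX !mulmx_block !mxtrace_block; congr (_ + _).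
  congr (\tr (_ + _ *m _)); apply: eq_mxcol => i; exact: EZ.
rewrite !mxtraceD; congr (_ + _).
  congr (\tr (_ *m _)); apply: eq_mxrow => i.
  by rewrite EZ trmx_mul trmxK.
rewrite !mul_mxdiag_mxblock !mxtrace_mxblock; apply: eq_bigr => i _.
by rewrite eqxx conform_mx_id EY.
Qed.

End Quadratic.

Section Arrowhead.
Variables (R : realType) (S k p : nat).

(** [Gammainv] forgets only blocks that vanish here. Hence [ccdot] with the data of (C) can be
    computed from the original matrices. *)
Lemma Gammainv_arrowheadK (M : symmx R (k + \sum_(i < S.+1) p)) :
    (forall i l, i != l -> submxblock (drsubmx M) i l = 0) ->
  Gamma (Gammainv M) = M.
Proof.
move=> M0; apply: val_inj; rewrite /= /Gamma_mx -[RHS]submxK; congr block_mx.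
- by rewrite /ccX ffunE /= block_mxKul.
- rewrite -[RHS]submxrowK; apply: eq_mxrow => i.
  by rewrite /ccZ ffunE /= block_mxKdl tr_submxcol trmx_dlsub symmxE.
- rewrite -[RHS]submxcolK; apply: eq_mxcol => i.
  by rewrite /ccZ ffunE /= block_mxKdl.
- rewrite -[RHS]submxblockK; apply: eq_mxblock => i l.
  have [<-|/M0->//] := eqVneq i l.
  by rewrite conform_mx_id /ccY ffunE /= block_mxKdr.
Qed.

(** Orthogonality of the [W i] makes the Gram matrix V^T V arrowhead, so its quadratic form at z is
    the squared norm of V z = [v]. *)
Lemma ccdot_gram m (U : 'M[R]_(m, k)) (W : 'I_S.+1 -> 'M[R]_(m, p)) x y
    (v := U *m x + \sum_i W i *m y i) :
    (forall i l, i != l -> (W i)^T *m W l = 0) ->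
  ccdot (Gammainv (gram (row_mx U (\mxrow_i W i)))) (outer_tuple x y) =
  (v^T *m v) 0 0.
Proof.
move=> W0; rewrite ccdot_outer Gammainv_arrowheadK /=; last first.
  move=> i l il; rewrite tr_row_mx mul_col_row block_mxKdr tr_mxrow.
  by rewrite mul_mxcol_mxrow mxblockK W0.
by rewrite mulmxA -mulmxA -trmx_mul mul_row_col mul_mxrow_mxcol.
Qed.

End Arrowhead.

Lemma sqnorm_mxE (R : realType) n (v : 'cV[R]_n) :
  (v^T *m v) 0 0 = \sum_i v i 0 ^+ 2.
Proof. by rewrite mxE; apply: eq_bigr => i _; rewrite mxE expr2. Qed.

Lemma sqnorm_mx_ge0 (R : realType) n (v : 'cV[R]_n) : 0 <= (v^T *m v) 0 0.
Proof. by rewrite sqnorm_mxE sumr_ge0 // => i _; rewrite sqr_ge0. Qed.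

Lemma sqnorm_mx_eq0 (R : realType) n (v : 'cV[R]_n) :
  (v^T *m v) 0 0 = 0 -> v = 0.
Proof.
rewrite sqnorm_mxE => /eqP; rewrite psumr_eq0 => [/allP v0|i _]; last first.
  exact: sqr_ge0.
apply/colP => i; rewrite mxE; apply/eqP.
by have := v0 i (mem_index_enum i); rewrite /= sqrf_eq0.
Qed.

(** * The data of (C) evaluated at lifted points *)

Section Lifting.
Variables (R : realType) (S n1 n2 : nat).
Implicit Types (t : R) (x : 'cV[R]_n1) (y : 'I_S.+1 -> 'cV[R]_n2).

(** Only column block i is nonzero, so distinct blocks have zero product and [ccdot_gram] applies;
    the column [- r] meets the homogenizing coordinate [t]. *)
Lemma ccdot_ccF m (F : 'M[R]_(m, n1)) (G : 'M[R]_(m, n2)) (r : 'cV[R]_m) i t x y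
    (v := F *m x + G *m y i - t *: r) :
  ccdot (ccF F G r i) (outer_tuple (col_mx t%:M x) y) = (v^T *m v) 0 0.
Proof.
rewrite ccdot_gram => [|j l jl]; last first.
  have [ji|_] := eqVneq j i; last by rewrite trmx0 mul0mx.
  by rewrite -ji eq_sym (negPf jl) mulmx0.
rewrite (bigD1 i) //= eqxx big1 ?addr0 => [|l /negPf->]; last by rewrite mul0mx.
rewrite mul_row_col mul_mx_scalar scalerN.
by rewrite /v [in RHS]addrC addrA.
Qed.

Lemma ccdot_ccH0 t x y :
  ccdot (ccH0 R S n1 n2) (outer_tuple (col_mx t%:M x) y) = t ^+ 2.
Proof.
rewrite ccdot_outer Gammainv_arrowheadK /=.
  rewrite mulmxA -mulmxA -[X in (X *m _) 0 0]trmxK trmx_mul trmxK.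
  rewrite sqnorm_mxE big_ord1; congr (_ ^+ 2).
  rewrite trmx_delta -rowE mxE.
  by rewrite !col_mxEu mxE eqxx.
move=> i l _; apply/matrixP => u w.
rewrite !mxE big_ord1 !mxE.
by rewrite eq_rlshift mul0r.
Qed.

Lemma ccdot_ccC A a B C c x y :
  ccdot (ccC A a B C c) (outer_tuple (col_mx 1%:M x) y) =
  objective A a B C c x y.
Proof.
rewrite ccdot_outer Gammainv_arrowheadK /=; last first.
  move=> i l il; rewrite block_mxKdr mxblockK.
  by rewrite (negPf il).
(* A 1 x 1 matrix equals its transpose, so the two mirror blocks of each mixed term contribute the
   same value and their halves add up. *)
have tr11 (M : 'M[R]_1) : M^T = M by rewrite [M]mx11_scalar tr_scalar_mx.
congr (fun_of_matrix _ 0 0); rewrite !tr_col_mx tr_scalar_mx !mul_row_block.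
rewrite !mul_row_col mulmx0 mul1mx add0r.
rewrite tr_mxcol mul_mxrow_mxcol mul_mxrow mul_mxrow_mxdiag -mxrowD.
rewrite mul_mxrow_mxcol mulmxDl mulmx_suml -addrA -big_split /=.
have half (v : 'M[R]_1) : 2^-1 *: v + 2^-1 *: v = v.
  by rewrite -scalerDl -div1r -splitr scale1r.
congr (_ + _).
  rewrite mul_row_col mulmx1 mulmxDl -scalemxAr -scalemxAl.
  by rewrite -[x^T *m a]tr11 trmx_mul trmxK addrA half addrC.
apply: eq_bigr => i _.
rewrite -mulmxA mul_row_col mulmx1 mul_row_col mul1mx !mulmxDr !mulmxDl.
rewrite -!scalemxAr -!scalemxAl -scalemxAr.
rewrite -[(y i)^T *m c i]tr11 trmx_mul trmxK.
rewrite -[(y i)^T *m (_ *m x)]tr11 !trmx_mul !trmxK.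
rewrite -[in RHS](half (x^T *m _ *m _)) -[in RHS](half (_^T *m y i)).
by rewrite !addrA [LHS](ACl (2*4*5*1*3)).
Qed.

End Lifting.

(** * Linearity of the inner product, and cones as convex sets *)

Lemma ccdot_is_scalar (R : realType) S k p (A : ccomp R S k p) :
  scalar (ccdot A).
Proof.
move=> t X Y; rewrite /ccdot Gamma_is_linear symmxD symmxZ.
by rewrite mulmxDr -scalemxAr linearP.
Qed.

HB.instance Definition _ (R : realType) S k p (A : ccomp R S k p) :=
  GRing.isLinear.Build R (ccomp R S k p) R _ (ccdot A) (ccdot_is_scalar A).

(** A convex combination is a sum of nonnegative multiples. This reduces the inclusion of [CMP] in a
    cone to its generators. *)
Lemma convex_set_of_cone (R : realType) (V : lmodType R) (P : set V) :
    (forall t X, 0 <= t -> P X -> P (t *: X)) ->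
    (forall X Y, P X -> P Y -> P (X + Y)) ->
  convex_set (P : set (convex_lmodType V)).
Proof.
move=> PZ PD X Y t /set_mem PX /set_mem PY; apply/mem_set.
apply: PD; apply: PZ => //.
by rewrite /unstable.onem subr_ge0.
Qed.

Theorem theorem8 (R : realType) (S n1 n2 nQ : nat) (m : 'I_S.+1 -> nat)
  (K0 : set 'cV[R]_n1) (K : 'I_S.+1 -> set 'cV[R]_n2)
  (A : symmx R n1) (a : 'cV[R]_n1)
  (B : 'I_S.+1 -> 'M[R]_(n1, n2)) (C : 'I_S.+1 -> symmx R n2)
  (c : 'I_S.+1 -> 'cV[R]_n2)
  (F : forall i : 'I_S.+1, 'M[R]_(m i, n1))
  (G : forall i : 'I_S.+1, 'M[R]_(m i, n2))
  (r : forall i : 'I_S.+1, 'cV[R]_(m i))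
  (Q : 'I_nQ -> 'cV[R]_(n1 + \sum_(i < S.+1) n2) -> R)
  (Qhat : 'I_nQ -> {scalar ccomp R S (1 + n1) n2})
  (K0_closed : closed K0) (K0_cone : convex_cone K0)
  (K_closed : forall i, closed (K i)) (K_cone : forall i, convex_cone (K i))
  (Q_quad : forall j, separable_quadratic (Q j))
  (feas_nonempty : forall i, feas K0 (K i) (F i) (G i) (r i) !=set0)
  (feas_bounded : forall i, bounded_set (feas K0 (K i) (F i) (G i) (r i)))
  (Q_ge0 : forall (x : 'cV[R]_n1) (y : 'I_S.+1 -> 'cV[R]_n2),
    (forall i, feas K0 (K i) (F i) (G i) (r i) (x, y i)) ->
    forall j, 0 <= Q j (stack x y))
  (Qhat_eq : forall j (x : 'cV[R]_n1) (y : 'I_S.+1 -> 'cV[R]_n2),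
    Qhat j (Gammainv (outer (hom_stack x y))) = Q j (stack x y)) :
  ereal_inf [set v : \bar R |
    exists (x : 'cV[R]_n1) (y : 'I_S.+1 -> 'cV[R]_n2),
    [/\ K0 x /\ (forall i, K i (y i)),
        forall i, F i *m x + G i *m y i = r i,
        forall j, Q j (stack x y) = 0 &
        v = (objective A a B C c x y)%:E]] =
  ereal_inf [set v : \bar R |
    exists X : ccomp R S (1 + n1) n2,
    [/\ ccdot (ccH0 R S n1 n2) X = 1,
        forall i, ccdot (ccF (F i) (G i) (r i) i) X = 0,
        forall j, Qhat j X = 0,
        CMP (nonneg_prod K0) K X &
        v = (ccdot (ccC A a B C c) X)%:E]].
Proof.
have QhatE j x y : Qhat j (outer_tuple (col_mx 1%:M x) y) = Q j (stack x y).
  by rewrite -Qhat_eq -Gammainv_outer.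
apply/eqP; rewrite eq_le; apply/andP; split; last first.
  apply: le_ereal_inf_tmp => _ [x [y [[K0x Ky] xy Q0 ->]]].
  apply: ereal_inf_lbound; exists (outer_tuple (col_mx 1%:M x) y); split.
  - by rewrite ccdot_ccH0 expr1n.
  - move=> i; rewrite ccdot_ccF xy scale1r subrr.
    by rewrite mulmx0 mxE.
  - by move=> j; rewrite QhatE.
  - apply: sub_gen_smallest; exists (col_mx 1%:M x), y; split => //.
    by exists 1, x.
  - by rewrite ccdot_ccC.
set vP := ereal_inf _.
apply: le_ereal_inf_tmp => _ [X [H0X FX QX CX ->]].
suff lb (v : R) : (v%:E <= vP)%E -> v <= ccdot (ccC A a B C c) X.
  (* If [vP] is +oo, every real is a lower bound, and taking the value at [X] plus 1 is absurd. *)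
  case: vP lb => [v|/(_ (ccdot (ccC A a B C c) X + 1))|] lb; last exact: leNye.
    by rewrite lee_fin lb.
  by move: (lb (leey _)); rewrite gerDl ler10.
move=> vlb.
have {}vlb x y : K0 x -> (forall i, K i (y i)) ->
    (forall i, F i *m x + G i *m y i = r i) ->
    (forall j, Q j (stack x y) = 0) ->
    v <= objective A a B C c x y.
  move=> *; rewrite -lee_fin; apply: (le_trans vlb).
  by apply: ereal_inf_lbound; exists x, y.
pose P := [set X : ccomp R S (1 + n1) n2 |
  (forall i, 0 <= ccdot (ccF (F i) (G i) (r i) i) X) /\
  ((forall i, ccdot (ccF (F i) (G i) (r i) i) X = 0) ->
   (forall j, 0 <= Qhat j X) /\
   ((forall j, Qhat j X = 0) ->
    v * ccdot (ccH0 R S n1 n2) X <= ccdot (ccC A a B C c) X))].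
suff : P X.
  by move=> [_ /(_ FX)[_ /(_ QX)]]; rewrite H0X mulr1.
have P0 : P 0.
  split=> [i|_]; first by rewrite linear0.
  by split=> [j|_]; rewrite !linear0 ?mulr0.
have PZ t Y : 0 <= t -> P Y -> P (t *: Y).
  (* Vanishing at [t *: Y] passes to [Y] only for t > 0, so t = 0 is treated apart through [P0]. *)
  rewrite le0r => /orP[/eqP-> _|t0 [FY QY]].
    by rewrite scale0r.
  split=> [i|FtY]; first by rewrite scalarZ; exact: mulr_ge0 (ltW t0) (FY i).
  have /QY[Qge Qle] i : ccdot (ccF (F i) (G i) (r i) i) Y = 0.
    by apply/eqP; have /eqP := FtY i; rewrite scalarZ mulf_eq0 gt_eqF.
  split=> [j|QtY]; first by rewrite scalarZ mulr_ge0 ?Qge // ltW.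
  rewrite !scalarZ mulrCA ler_pM2l // Qle // => j.
  by apply/eqP; have /eqP := QtY j; rewrite scalarZ mulf_eq0 gt_eqF.
have PD Y Z : P Y -> P Z -> P (Y + Z).
  move=> [FY QY] [FZ QZ]; split=> [i|FYZ].
    by rewrite linearD; exact: addr_ge0 (FY i) (FZ i).
  have /all_and2[FY0 FZ0] i : ccdot (ccF (F i) (G i) (r i) i) Y = 0 /\
      ccdot (ccF (F i) (G i) (r i) i) Z = 0.
    have /eqP := FYZ i; rewrite linearD.
    by rewrite (paddr_eq0 (FY i) (FZ i)) => /andP[/eqP ? /eqP ?].
  have [QY0 CY] := QY FY0; have [QZ0 CZ] := QZ FZ0.
  split=> [j|QYZ].
    by rewrite linearD; exact: addr_ge0 (QY0 j) (QZ0 j).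
  have /all_and2[QY1 QZ1] j : Qhat j Y = 0 /\ Qhat j Z = 0.
    have /eqP := QYZ j; rewrite linearD.
    by rewrite (paddr_eq0 (QY0 j) (QZ0 j)) => /andP[/eqP ? /eqP ?].
  by rewrite !linearD mulrDr lerD ?CY ?CZ.
apply: (smallest_sub (convex_set_of_cone PZ PD) _ CX).
move=> _ [_ [y [[t [x [t0 K0x ->]]] Ky ->]]].
split=> [i|F0]; first by rewrite ccdot_ccF sqnorm_mx_ge0.
(* The full membership is restored as the goal so that [P0] and [PZ] apply, while [F0] stays
   available. *)
suff [_] : P (outer_tuple (col_mx t%:M x) y) by apply.
have {}F0 i : F i *m x + G i *m y i = t *: r i.
  by apply/subr0_eq/sqnorm_mx_eq0; rewrite -ccdot_ccF.
move: t0; rewrite le0r => /orP[/eqP t0|t0].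
  subst t.
  have xy0 i : (x, y i) = 0.
    have [[u w] [/= K0u Kw uw]] := feas_nonempty i.
    apply: (bounded_ray (u := (u, w)) (feas_bounded i)) => t t0; split=> /=.
    - exact: convex_coneD K0_cone K0u (K0_cone.2 _ _ t0 K0x).
    - exact: convex_coneD (K_cone i) Kw ((K_cone i).2 _ _ t0 (Ky i)).
    - rewrite !mulmxDr addrACA uw -!scalemxAr -scalerDr F0.
      by rewrite scale0r scaler0 addr0.
  have -> : outer_tuple (col_mx 0%:M x) y = 0.
    (* Any single block forces x = 0; [ord0] exists since there are [S.+1] blocks. *)
    have -> : x = 0 by have [] := xy0 ord0.
    (* Zeros are written [0 *: 0] so that [outer_tupleZ] extracts the factor 0 ^+ 2. *)
    have -> : y = fun i => 0 *: 0.
      by apply/funext => i; have [] := xy0 i; rewrite scaler0.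
    have -> : col_mx 0%:M 0 = 0 *: 0 :> 'cV[R]_(1 + n1).
      by rewrite scaler0 raddf0 col_mx0.
    by rewrite outer_tupleZ expr0n scale0r.
  exact: P0.
(* Normalizing the first coordinate to 1 costs a factor t^2, as generators are quadratic in the
   vector. *)
have -> : outer_tuple (col_mx t%:M x) y =
    t ^+ 2 *: outer_tuple (col_mx 1%:M (t^-1 *: x)) (fun i => t^-1 *: y i).
  rewrite -outer_tupleZ scale_col_mx scalerA divff ?gt_eqF // scale1r.
  rewrite scale_scalar_mx mulr1; congr outer_tuple.
  by apply/funext => i; rewrite scalerA divff ?gt_eqF // scale1r.
apply: PZ; first exact: sqr_ge0.
set x' := t^-1 *: x; set y' := fun i => _.
have K0x' : K0 x' by apply: K0_cone.2 => //; rewrite invr_ge0 ltW.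
have Ky' i : K i (y' i) by apply: (K_cone i).2 => //; rewrite invr_ge0 ltW.
have xy' i : F i *m x' + G i *m y' i = r i.
  by rewrite -!scalemxAr -scalerDr F0 scalerA mulVf ?gt_eqF // scale1r.
split=> [i|_]; first by rewrite ccdot_ccF sqnorm_mx_ge0.
split=> [j|Q0]; first by rewrite QhatE; apply: Q_ge0.
rewrite ccdot_ccH0 expr1n mulr1 ccdot_ccC; apply: vlb => // j.
by rewrite -QhatE.
Qed.
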